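(* Let $\epsilon\in[0,1)$, and let $P_n=\{x_1,\dots,x_n\}\subseteq\Omega_{\text{free}}$ be the set of $n$ sensors placed by the $\epsilon$-greedy algorithm with gain function $\mathcal{G}_k$; that is, with $P_0=\emptyset$ and $P_m=\{x_1,\dots,x_m\}$, for every $0\le m\le n-1$ the point $x_{m+1}\in\Omega_{\text{free}}$ satisfies $$\mathcal{G}_k(x_{m+1},P_m)\ \ge\ (1-\epsilon)\max_{z\in\Omega_{\text{free}}}\mathcal{G}_k(z,P_m).$$ If $$P_l^*=\{x_1^*,\dots,x_l^*\}\in\operatorname*{arg\,max}_{P\subseteq\Omega_{\text{free}},\ |P|=l} f_k(P),$$ then $$f_k(P_n)\ \ge\ \left(1-e^{-(1-\epsilon)\frac{n}{l}}\right) f_k(P_l^* ).$$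
   Context: The environment $\Omega\subset\mathbb{R}^d$ ($d=2$ or $3$) is bounded and is the disjoint union $\Omega=\Omega_{\text{obs}}\cup\Omega_{\text{free}}$ of obstacles and free space. For $x,y\in\Omega_{\text{free}}$, $y$ is visible from $x$ if $tx+(1-t)y\in\Omega_{\text{free}}$ for all $t\in[0,1]$. The visibility function is $\phi_x(y)=1$ if $y$ is visible from $x$ and $\phi_x(y)=0$ otherwise. It is assumed that $\Omega_{\text{free}}$ and all functions $\phi_x$ are Lebesgue measurable. For a set $P\subseteq\Omega_{\text{free}}$ of sensor locations, the order of visibility is $\mathcal{O}_{\text{vis}}(y,P)=\sum_{x\in P}\phi_x(y)$. For an integer $k\ge1$ and weights $w_1,\dots,w_k\in\mathbb{R}$, the coverage of a set $P$ of sensors is $$f_k(P)=\sum_{i=1}^k w_i\int_{\Omega_{\text{free}}}\mathbf{1}_{\{\mathcal{O}_{\text{vis}}(z,P)\ge i\}}\,dz,$$ and the gain function is $\mathcal{G}_k(x,P)=f_k(P\cup\{x\})-f_k(P)$ for $x\in\Omega_{\text{free}}$. Here $n,l\ge1$ are integers. The $\epsilon$-greedy algorithm starts from the empty list of sensors and at each step appends a randomly chosen point of $\Omega_{\text{free}}$ whose gain is at least $(1-\epsilon)$ times the maximal gain over $\Omega_{\text{free}}$ (the maxima are assumed to be attained).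
   Formalization: The weights are additionally assumed nonincreasing and nonnegative (w_1 ≥ … ≥ w_k ≥ 0); for arbitrary real weights the bound is false, e.g. k = n = l = 1, w_1 = −1, ε = 0 with a convex free space of positive volume. *)

(* Defs.v *)
From HB Require Import structures.
From mathcomp Require Import all_boot all_order all_algebra finmap.
From mathcomp Require Import all_classical all_reals all_analysis.
Set Implicit Arguments.
Unset Strict Implicit.
Unset Printing Implicit Defensive.
Import Order.TTheory GRing.Theory Num.Theory.
Import numFieldNormedType.Exports.
Local Open Scope classical_set_scope.
Local Open Scope ring_scope.

(* Lebesgue measure on R^d: the Caratheodory measure of the outer measure
   inf { \sum_k vol (B_k) | A `<=` \bigcup_k B_k, each B_k a box }. *)

Definition box (R : realType) (d : nat) (a b : 'rV[R]_d) : set 'rV[R]_d :=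
  [set x | forall i, x ord0 i \in `]a ord0 i, b ord0 i] ].

(* The infimum of the empty set is +oo, so this is +oo on sets other than
   boxes. The first disjunct matters only for d = 0, where no box is empty. *)
Definition box_volume (R : realType) (d : nat) (B : set 'rV[R]_d) : \bar R :=
  ereal_inf [set v | (B = set0 /\ v = 0%E) \/
    exists a b : 'rV[R]_d, [/\ forall i, a ord0 i <= b ord0 i, B = box a b
                             & v = (\prod_i (b ord0 i - a ord0 i))%:E]].

(* [mu_ext] expects a set function on a semiring of sets. With the power set as
   that semiring and +oo as the value on sets other than boxes, only covers by
   boxes count. *)
Definition powerset_rV (R : realType) (d : nat) : Type := 'rV[R]_d.

HB.instance Definition _ (R : realType) (d : nat) :=
  Pointed.on (powerset_rV R d).
HB.instance Definition _ (R : realType) (d : nat) :=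
  @isMeasurable.Build default_measure_display (powerset_rV R d)
    discrete_measurable discrete_measurable0
    discrete_measurableC discrete_measurableU.

Definition lebesgue_outer (R : realType) (d : nat) :
    set 'rV[R]_d -> \bar R :=
  @mu_ext _ (powerset_rV R d) R (@box_volume R d).

Lemma box_volume0 (R : realType) (d : nat) : box_volume (@set0 'rV[R]_d) = 0%E.
Proof.
apply/eqP; rewrite eq_le; apply/andP; split.
  by apply: ereal_inf_lbound; left.
apply: le_ereal_inf_tmp => v /= [[_ ->]//|[a [b [ab _ ->]]]].
by rewrite lee_fin; apply: prodr_ge0 => i _; rewrite subr_ge0.
Qed.

Lemma box_volume_ge0 (R : realType) (d : nat) (B : set 'rV[R]_d) :
  (0 <= box_volume B)%E.
Proof.
apply: le_ereal_inf_tmp => v /= [[_ ->]//|[a [b [ab _ ->]]]].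
by rewrite lee_fin; apply: prodr_ge0 => i _; rewrite subr_ge0.
Qed.

HB.instance Definition _ (R : realType) (d : nat) :=
  isOuterMeasure.Build R 'rV[R]_d (@lebesgue_outer R d)
    (@mu_ext0 _ (powerset_rV R d) R _ (box_volume0 R d) (@box_volume_ge0 R d))
    (@mu_ext_ge0 _ (powerset_rV R d) R _ (@box_volume_ge0 R d))
    (@le_mu_ext _ (powerset_rV R d) R _)
    (@mu_ext_sigma_subadditive _ (powerset_rV R d) R _ (@box_volume_ge0 R d)).

(* 'rV[R]_d with the Lebesgue sigma-algebra. *)
Definition lebesgue_rV (R : realType) (d : nat) :=
  caratheodory_type (@lebesgue_outer R d).

HB.instance Definition _ (R : realType) (d : nat) :=
  Measurable.on (lebesgue_rV R d).

Definition lebesgue_measure_rV (R : realType) (d : nat) :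
    set (lebesgue_rV R d) -> \bar R :=
  @lebesgue_outer R d.

HB.instance Definition _ (R : realType) (d : nat) :=
  isMeasure.Build _ (lebesgue_rV R d) R (@lebesgue_measure_rV R d)
    (caratheodory_measure0 (@lebesgue_outer R d))
    (@caratheodory_measure_ge0 _ _ (@lebesgue_outer R d))
    (@caratheodory_measure_sigma_additive _ _ (@lebesgue_outer R d)).

Section Coverage.
Context (R : realType) (d : nat).
Implicit Types (free : set 'rV[R]_d) (x y : 'rV[R]_d) (P : {fset 'rV[R]_d}).

Definition visible free x y : Prop :=
  forall t : R, 0 <= t <= 1 -> free (t *: x + (1 - t) *: y).

Definition visibility free x : lebesgue_rV R d -> R :=
  \1_[set y : 'rV[R]_d | visible free x y].

Definition visibility_order free y P : R :=
  \sum_(x <- P) visibility free x y.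

Definition coverage free (k : nat) (w : nat -> R) P : R :=
  \sum_(1 <= i < k.+1)
    w i * \int[@lebesgue_measure_rV R d]_(z in free)
      (\1_[set z : lebesgue_rV R d | i%:R <= visibility_order free z P] z : R).

Definition gain free (k : nat) (w : nat -> R) x P : R :=
  coverage free k w (x |` P)%fset - coverage free k w P.

(* Sensors are numbered from 1, as x 1, x 2 and so on; x 0 is not used. *)
Definition sensors (x : nat -> 'rV[R]_d) (m : nat) : {fset 'rV[R]_d} :=
  [fset x i | i in iota 1 m]%fset.

Definition is_maximum (E : set R) (M : R) : Prop := E M /\ ubound E M.

Definition eps_greedy free (k : nat) (w : nat -> R) (eps : R) (n : nat)
    (x : nat -> 'rV[R]_d) : Prop :=
  forall m, (m < n)%N -> free (x m.+1) /\
    exists M : R,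
      is_maximum [set gain free k w z (sensors x m) | z in free] M /\
      (1 - eps) * M <= gain free k w (x m.+1) (sensors x m).

Definition argmax_coverage free (k : nat) (w : nat -> R) (l : nat) :
    set {fset 'rV[R]_d} :=
  [set P | [/\ [set` P] `<=` free, #|` P|%fset = l &
    forall Q : {fset 'rV[R]_d}, [set` Q] `<=` free -> #|` Q|%fset = l ->
      coverage free k w Q <= coverage free k w P]].

End Coverage.

(* Main.v *)
Require Import Defs.
From HB Require Import structures.
From mathcomp Require Import all_boot all_order all_algebra finmap.
From mathcomp Require Import all_classical all_reals all_analysis.
From mathcomp Require Import measurable_realfun lra.
Import Order.TTheory GRing.Theory Num.Theory.
Import numFieldNormedType.Exports.
Local Open Scope classical_set_scope.
Local Open Scope ring_scope.

(** A point seen by [m] sensors contributes [utility k w m], which is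
nondecreasing and concave in [m] because the weights are nonnegative and
nonincreasing. For the coverage [f], concavity gives, pointwise and hence after integration,
[f T <= f S + \sum_(x <- T) gain x S]. With [T] optimal of size [l] and [S] the
current greedy set, some point has gain at least [(f T - f S) / l], so each
greedy step multiplies the gap to the optimum by at most [1 - (1 - eps) / l]. *)

(** * Finite sums under the integral, and finite outer measure of bounded sets *)

Lemma Rintegral_sum (disp : measure_display) (T : measurableType disp)
    (R : realType) (mu : {measure set T -> \bar R}) (D : set T)
    (I : Type) (s : seq I) (f : I -> T -> R) :
  measurable D -> (forall i, mu.-integrable D (EFin \o f i)) ->
  \int[mu]_(z in D) (\sum_(i <- s) f i z) =
    \sum_(i <- s) \int[mu]_(z in D) f i z.
Proof.
move=> mD intf; elim: s => [|i s IH].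
  by under eq_Rintegral do rewrite big_nil; rewrite Rintegral_cst// mul0r big_nil.
under eq_Rintegral do rewrite big_cons.
rewrite RintegralD//; first by rewrite IH big_cons.
apply: eq_integrable (integrable_sum mD s (fun i _ => intf i)) => // z _ /=.
by rewrite sumEFin.
Qed.

Lemma normr_entry_le (R : realType) (d : nat) (x : 'rV[R]_d) (i : 'I_d) :
  `|x ord0 i| <= `|x|.
Proof.
rewrite {2}/Num.norm/= mx_normrE.
exact: (le_bigmax _ (fun ij => `|x ij.1 ij.2|) (ord0, i)).
Qed.

Lemma lebesgue_outer_box_le (R : realType) (d : nat) (a b : 'rV[R]_d) :
  (forall i, a ord0 i <= b ord0 i) ->
  (lebesgue_outer (box a b) <= (\prod_i (b ord0 i - a ord0 i))%:E)%E.
Proof.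
move=> ab; apply: (@le_trans _ _ (box_volume (box a b))); last first.
  by apply: ereal_inf_lbound; right; exists a, b.
apply: ereal_inf_lbound.
exists (fun n : nat => if n == 0%N then box a b else set0).
  by split=> [//|t Xt]; exists 0%N.
(* The partial sum of index 0 is empty; after the shift by one the sequence is constant. *)
apply/cvg_lim => //; rewrite -cvg_shiftS.
rewrite (_ : [sequence _]_n = cst (box_volume (box a b))).
  exact: cvg_cst.
rewrite funeqE => n /=; rewrite big_nat_recl//= big1 ?adde0// => i _.
exact: box_volume0.
Qed.

Lemma lebesgue_outer_bounded (R : realType) (d : nat) (A : set 'rV[R]_d) :
  bounded_set A -> (lebesgue_outer A < +oo)%E.
Proof.
move=> [M [_ /(_ (`|M| + 1))]] AM.
have {}AM x : A x -> `|x| <= `|M| + 1.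
  by apply: AM; rewrite ltr_pwDr// ler_norm.
(* Boxes are open on the left, so the second 1 makes the bound on the entries strict. *)
pose c := `|M| + 1 + 1.
have c0 : 0 <= c by rewrite !addr_ge0.
have sub : A `<=` box (const_mx (- c)) (const_mx c).
  move=> x /AM xc i; rewrite !mxE.
  have : `|x ord0 i| < c.
    by apply: le_lt_trans (normr_entry_le _ _ _ _) _; apply: le_lt_trans xc _; rewrite ltrDl.
  by rewrite ltr_norml in_itv/= => /andP[-> /ltW ->].
apply: le_lt_trans (le_outer_measure (@lebesgue_outer R d) _ _ sub) _.
apply: le_lt_trans (lebesgue_outer_box_le R d _ _ _) _ => [i|].
  by rewrite !mxE; lra.
exact: ltry.
Qed.

(** * Value of a point as a concave function of the number of sensors that see it *)

Definition utility {R : realType} (k : nat) (w : nat -> R) (m : nat) : R :=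
  \sum_(1 <= i < k.+1) w i * (i <= m)%N%:R.

Lemma utility0 (R : realType) (k : nat) (w : nat -> R) : utility k w 0 = 0.
Proof.
rewrite /utility big_nat big1// => i /andP[i1 _].
by rewrite leqNgt i1 mulr0.
Qed.

(** Only the summand of index [m.+1] changes, and it is present exactly when [m < k]. *)
Lemma utilityS (R : realType) (k : nat) (w : nat -> R) (m : nat) :
  utility k w m.+1 = utility k w m + if (m < k)%N then w m.+1 else 0.
Proof.
have -> : (if (m < k)%N then w m.+1 else 0) =
    \sum_(1 <= i < k.+1) w i * (i == m.+1)%:R.
  rewrite big_add1 /= big_mkord.
  case: ltnP => mk.
    rewrite (bigD1 (Ordinal mk))//= eqxx mulr1 big1 ?addr0// => i.
    by rewrite -val_eqE/= eqSS => /negbTE ->; rewrite mulr0.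
  rewrite big1// => i _; rewrite eqSS.
  by rewrite ltn_eqF ?mulr0// (leq_trans _ mk).
rewrite /utility -big_split/=; apply: eq_bigr => i _.
rewrite -mulrDr -natrD; congr (_ * _%:R).
by rewrite leq_eqVlt ltnS; have [->|_] := eqVneq i m.+1; rewrite ?ltnn//= addn0.
Qed.

Section ConcaveUtility.
Context {R : realType} {k : nat} {w : nat -> R}.
Context (w_nonincreasing : forall i, (1 <= i < k)%N -> w i.+1 <= w i).
Context (w_ge0 : 0 <= w k).

Let increment m : R := utility k w m.+1 - utility k w m.

Let incrementE m : increment m = if (m < k)%N then w m.+1 else 0.
Proof. by rewrite /increment utilityS addrC addKr. Qed.

(** Nonincreasing weights are bounded below by the last one, [w k]; the induction is on the distance
    [j] from [m.+1] to [k]. *)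
Let weight_ge0 m : (m < k)%N -> 0 <= w m.+1.
Proof.
move=> mk.
have [j jE] : exists j, k = (m.+1 + j)%N by exists (k - m.+1)%N; rewrite subnKC.
elim: j m mk jE => [|j IH] m mk jE; first by rewrite addn0 in jE; rewrite -jE.
have mk' : (m.+1 < k)%N by rewrite jE addnS ltnS leq_addr.
apply: le_trans (w_nonincreasing m.+1 mk').
by apply: IH; rewrite // addSnnS.
Qed.

Let increment_ge0 m : 0 <= increment m.
Proof. by rewrite incrementE; case: ifPn => // /weight_ge0. Qed.

Let increment_nonincreasing m j : increment (m + j) <= increment m.
Proof.
elim: j => [|j]; first by rewrite addn0.
apply: le_trans; rewrite addnS; move: (m + j)%N => {m j} m.
(* Below [k] this is monotonicity of the weights; from [k] on the later increment is 0, and the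
   earlier one is nonnegative. *)
rewrite [leLHS]incrementE; case: ifPn => mk; last exact: increment_ge0.
by rewrite incrementE (ltn_trans _ mk)// w_nonincreasing.
Qed.

Lemma utility_le m m' : (m <= m')%N -> utility k w m <= utility k w m'.
Proof.
move=> /subnKC <-; elim: (m' - m)%N => [|j IH]; first by rewrite addn0.
rewrite addnS; apply: (le_trans IH).
by rewrite -subr_ge0; exact: increment_ge0.
Qed.

Lemma utility_ge0 m : 0 <= utility k w m.
Proof. by rewrite -(utility0 _ k w) utility_le. Qed.

(** By concavity each of the [j] increments after [m] is at most the first. *)
Lemma utilityD_le m j :
  utility k w (m + j) <=
    utility k w m + j%:R * (utility k w m.+1 - utility k w m).
Proof.
elim: j => [|j IH]; first by rewrite addn0 mul0r addr0.
rewrite addnS -natr1.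
have := increment_nonincreasing m j; rewrite /increment => H.
by lra.
Qed.

End ConcaveUtility.

(** * Counting the sensors that see a fixed point *)

Section VisibilityCount.
Context {R : realType} {d : nat}.
Implicit Types (free : set 'rV[R]_d) (x y : 'rV[R]_d) (P S T : {fset 'rV[R]_d}).

Definition visibility_count free P (z : lebesgue_rV R d) : nat :=
  count (fun x => `[< visible free x z >]) P.

Lemma visibility_orderE free P z :
  visibility_order free z P = (visibility_count free P z)%:R.
Proof.
rewrite /visibility_order /visibility_count -sum1_count [in RHS]big_mkcond natr_sum.
apply: eq_bigr => x _; rewrite /visibility indicE.
case: asboolP => xz; first by rewrite mem_set.
by rewrite memNset.
Qed.

Lemma visibility_countU1 free x P z :
  visibility_count free (x |` P)%fset z =
    (visibility_count free P z + ((x \notin P) && `[< visible free x z >]))%N.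
Proof.
have [xP|xP] /= := boolP (x \in P); first by rewrite mem_fset1U ?addn0.
rewrite /visibility_count -!sum1_count !big_mkcond big_fsetU1//= addnC.
by rewrite -big_mkcond; case: `[< visible free x z >].
Qed.

(** The sensors of [T] that see [z] split into those in [S], which are distinct and hence at most
    the count of [S], and those outside [S]. *)
Lemma visibility_count_le free S T z :
  (visibility_count free T z <= visibility_count free S z +
    count (fun x => (x \notin S) && `[< visible free x z >]) T)%N.
Proof.
rewrite /visibility_count.
set p := fun x => `[< visible free x z >].
rewrite -[count p T]size_filter -(count_predC (mem S) [seq x <- T | p x]).
apply: leq_add; last by rewrite count_filter.
rewrite -!size_filter; apply: uniq_leq_size => [|x].
  by rewrite !filter_uniq// fset_uniq.
by rewrite !mem_filter => /and3P[xS -> _].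
Qed.

(** If [j] sensors of [T] outside [S] see [z], the sum on the right is exactly [j] times one
    increment of [utility], since the other points of [T] do not change the count. Monotonicity and
    [utilityD_le] conclude. *)
Lemma utility_visibility_le free (k : nat) (w : nat -> R) S T z :
  (forall i, (1 <= i < k)%N -> w i.+1 <= w i) -> 0 <= w k ->
  utility k w (visibility_count free T z) <=
    utility k w (visibility_count free S z) +
    \sum_(x <- T) (utility k w (visibility_count free (x |` S)%fset z) -
                   utility k w (visibility_count free S z)).
Proof.
move=> w_noninc w_ge0; set c := visibility_count free S z.
apply: le_trans (utility_le w_noninc w_ge0 _ _ (visibility_count_le free S T z)) _.
apply: le_trans (utilityD_le w_noninc w_ge0 _ _) _.
rewrite lerD2l -sum1_count big_mkcond natr_sum mulr_suml.
apply: ler_sum => x _; rewrite visibility_countU1 -/c.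
by case: ifP => _; rewrite ?addn1 ?addn0 ?mul1r// mul0r subrr.
Qed.

End VisibilityCount.

(** * Coverage as an integral, and its bound by gains of single sensors *)

Section CoverageIntegral.
Context {R : realType} {d : nat} (free : set 'rV[R]_d).
Context (free_bounded : bounded_set free).
Context (free_measurable : measurable (free : set (lebesgue_rV R d))).
Context (visibility_measurable : forall x : 'rV[R]_d, free x ->
  measurable_fun (free : set (lebesgue_rV R d)) (visibility free x)).
Context (k : nat) (w : nat -> R).
Implicit Types (x : 'rV[R]_d) (P S T : {fset 'rV[R]_d}).

Let mu := @lebesgue_measure_rV R d.

(* At [t = 1] the segment is at [x], so nothing is visible from [x] outside [free]. *)
Let measurable_visibility x :
  measurable_fun (free : set (lebesgue_rV R d)) (visibility free x).
Proof.
have [/visibility_measurable//|nfx] := pselect (free x).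
apply: (eq_measurable_fun (cst 0 : lebesgue_rV R d -> R));
  last exact: measurable_cst.
move=> z _; rewrite /visibility indicE memNset// => /(_ 1).
by rewrite subrr scale1r scale0r addr0 ler01 lexx => /(_ isT).
Qed.

Let integrable_layer i P :
  mu.-integrable (free : set (lebesgue_rV R d))
    (EFin \o \1_[set z : lebesgue_rV R d | i%:R <= visibility_order free z P]).
Proof.
set A := [set z | _].
have mA : measurable ((free : set (lebesgue_rV R d)) `&` A).
  have mv : measurable_fun (free : set (lebesgue_rV R d))
      (fun z => visibility_order free z P).
    exact: measurable_sum.
  (* Inside [free], the layer [A] is the preimage of a closed half-line under the order of
     visibility. *)
  have := mv free_measurable [set` `[i%:R, +oo[] (measurable_itv _).
  congr (measurable (_ `&` _)); apply/seteqP; split=> z /=;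
    by rewrite in_itv/= andbT.
apply: measurable_bounded_integrable => //.
- exact: lebesgue_outer_bounded.
(* Only the trace of [A] on [free] is known to be measurable, so the indicator is replaced by one
   that agrees with it on [free]. *)
- apply: (eq_measurable_fun (\1_(free `&` A) : lebesgue_rV R d -> R)).
    by move=> z zfree; rewrite !indicE in_setI zfree.
  exact: measurable_indic.
- exists 1; split=> // M M1 z _ /=.
  rewrite indicE ger0_norm//; case: (_ \in _) => /=; first exact: ltW.
  by rewrite (le_trans _ (ltW M1)).
Qed.

Let density P (z : lebesgue_rV R d) : R :=
  utility k w (visibility_count free P z).

Let densityE P z : density P z = \sum_(1 <= i < k.+1)
  w i * \1_[set z : lebesgue_rV R d | i%:R <= visibility_order free z P] z.
Proof.
apply: eq_bigr => i _; congr (_ * _).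
rewrite indicE; congr (_%:R); congr nat_of_bool.
apply/idP/idP.
  by move=> h; apply/mem_set; rewrite /= visibility_orderE ler_nat.
by move/set_mem; rewrite /= visibility_orderE ler_nat.
Qed.

Let integrable_weighted_layer P i :
  mu.-integrable (free : set (lebesgue_rV R d)) (EFin \o (fun z =>
    w i * \1_[set z : lebesgue_rV R d | i%:R <= visibility_order free z P] z)).
Proof.
apply: eq_integrable (integrableZl free_measurable (w i) (integrable_layer i P)) => //.
Qed.

Let integrable_density P :
  mu.-integrable (free : set (lebesgue_rV R d)) (EFin \o density P).
Proof.
apply: eq_integrable (integrable_sum free_measurable (index_iota 1 k.+1)
  (fun i _ => integrable_weighted_layer P i)) => // z _ /=.
by rewrite densityE sumEFin.
Qed.

(** Exchanging the sum over layers with the integral leaves a single integrand, to which pointwise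
    inequalities apply. *)
Let coverageE P : coverage free k w P = \int[mu]_(z in free) density P z.
Proof.
under eq_Rintegral do rewrite densityE.
rewrite Rintegral_sum//.
by apply: eq_bigr => i _; rewrite RintegralZl.
Qed.

Lemma coverage0 : coverage free k w fset0 = 0.
Proof.
rewrite coverageE; under eq_Rintegral do
  rewrite /density /visibility_count /= utility0.
by rewrite Rintegral_cst// mul0r.
Qed.

Context (w_nonincreasing : forall i, (1 <= i < k)%N -> w i.+1 <= w i).
Context (w_ge0 : 0 <= w k).

Lemma coverage_ge0 P : 0 <= coverage free k w P.
Proof.
by rewrite coverageE; apply: Rintegral_ge0 => z _; exact: utility_ge0.
Qed.

(** By linearity both sides are integrals over [free], and the integrands are compared by
    [utility_visibility_le]. *)
Lemma coverage_le_sum_gain S T :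
  coverage free k w T <= coverage free k w S + \sum_(x <- T) gain free k w x S.
Proof.
have gainE x : gain free k w x S =
    \int[mu]_(z in free) (density (x |` S)%fset z - density S z).
  by rewrite /gain !coverageE RintegralB.
have int_diff x : mu.-integrable (free : set (lebesgue_rV R d))
    (EFin \o (fun z => density (x |` S)%fset z - density S z)).
  apply: eq_integrable (integrableB free_measurable
    (integrable_density (x |` S)%fset) (integrable_density S)) => //.
under eq_bigr do rewrite gainE.
rewrite -Rintegral_sum// !coverageE.
have int_sum : mu.-integrable (free : set (lebesgue_rV R d))
    (EFin \o (fun z => \sum_(x <- T) (density (x |` S)%fset z - density S z))).
  apply: eq_integrable (integrable_sum free_measurable T
    (fun x _ => int_diff x)) => // z _ /=.
  by rewrite sumEFin.
rewrite -RintegralD//; apply: le_Rintegral => //.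
  by apply: eq_integrable (integrableD free_measurable
    (integrable_density S) int_sum).
by move=> z _; exact: utility_visibility_le.
Qed.

End CoverageIntegral.

(** * Greedy recursion and the final bound *)

Lemma geometric_gap (R : realType) (f : nat -> R) (F r : R) (n : nat) :
  f 0 = 0 -> 0 <= F -> r <= 1 ->
  (forall m, (m < n)%N -> r * (F - f m) <= f m.+1 - f m) ->
  (1 - expR (- (r * n%:R))) * F <= f n.
Proof.
move=> f0 F0 r1 step.
have gap m : (m <= n)%N -> F - f m <= (1 - r) ^+ m * F.
  elim: m => [|m IH] mn; first by rewrite f0 subr0 expr0 mul1r.
  have h : F - f m.+1 <= (1 - r) * (F - f m).
    by have := step m mn; lra.
  (* Here [r <= 1] makes the factor [1 - r] nonnegative, so it can multiply the induction
     hypothesis. *)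
  apply: (le_trans h); rewrite exprS -mulrA ler_wpM2l ?subr_ge0// IH//.
  exact: ltnW.
(* This is [1 + y <= expR y] at [y = - r], raised to the power [n]. *)
have : (1 - r) ^+ n * F <= expR (- (r * n%:R)) * F.
  rewrite ler_wpM2r// -mulNr mulrC expRM_natl.
  by rewrite lerXn2r ?nnegrE ?subr_ge0 ?expR_ge0// expR_ge1Dx.
have := gap n (leqnn n); lra.
Qed.

(** Brings the next greedy set to the form used in [gain], so that a difference of consecutive
    coverages is a gain. *)
Lemma sensorsS (R : realType) (d : nat) (x : nat -> 'rV[R]_d) (m : nat) :
  sensors x m.+1 = (x m.+1 |` sensors x m)%fset.
Proof.
have iotaS : iota 1 m.+1 = iota 1 m ++ [:: m.+1].
  by rewrite -[in LHS](addn1 m) iotaD add1n.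
apply/fsetP => y; rewrite /sensors iotaS.
rewrite in_fset1U; apply/imfsetP/orP => /= [[i]|].
  rewrite mem_cat => /orP[im ->|].
    by right; apply/imfsetP; exists i.
  by rewrite mem_seq1 => /eqP -> ->; left.
case=> [/eqP ->|/imfsetP[i/= im ->]].
  by exists m.+1; rewrite // mem_cat mem_seq1 eqxx orbT.
by exists i; rewrite // mem_cat im.
Qed.

(* The bound fails for arbitrary real weights, already for k = n = l = 1, w_1 = -1,
   eps = 0 and a convex free space of positive measure, where both sets have
   coverage - mu free. The weights are therefore taken nonincreasing and
   nonnegative, which makes the coverage monotone and submodular. *)
Theorem theorem3p1 (R : realType) (d : nat) (hd : d = 2%N \/ d = 3%N)
  (Omega obs free : set 'rV[R]_d)
  (Omega_bounded : bounded_set Omega)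
  (Omega_split : Omega = obs `|` free)
  (obs_free_disjoint : obs `&` free = set0)
  (free_measurable : measurable (free : set (lebesgue_rV R d)))
  (visibility_measurable : forall x : 'rV[R]_d, free x ->
    measurable_fun (free : set (lebesgue_rV R d)) (visibility free x))
  (k : nat) (k_ge1 : (1 <= k)%N) (w : nat -> R)
  (w_nonincreasing : forall i, (1 <= i < k)%N -> w i.+1 <= w i)
  (w_ge0 : 0 <= w k)
  (n l : nat) (n_ge1 : (1 <= n)%N) (l_ge1 : (1 <= l)%N)
  (eps : R) (eps_ge0 : 0 <= eps) (eps_lt1 : eps < 1)
  (x : nat -> 'rV[R]_d) (x_greedy : eps_greedy free k w eps n x)
  (Pstar : {fset 'rV[R]_d}) (Pstar_max : argmax_coverage free k w l Pstar) :
  (1 - expR (- ((1 - eps) * (n%:R / l%:R)))) * coverage free k w Pstar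
    <= coverage free k w (sensors x n).
Proof.
have free_bounded : bounded_set free.
  case: Omega_bounded => M [Mr H]; exists M; split=> // N MN z zfree.
  by apply: (H N MN); rewrite Omega_split; right.
have [Pfree Pcard _] := Pstar_max.
set F := coverage free k w Pstar.
have l0 : 0 < l%:R :> R by rewrite ltr0n.
(* Isolates the contraction rate [r = (1 - eps) / l] required by [geometric_gap]. *)
have -> : (1 - eps) * (n%:R / l%:R) = (1 - eps) / l%:R * n%:R.
  by rewrite mulrCA mulrC.
apply: (geometric_gap _ (fun m => coverage free k w (sensors x m))).
- have -> : sensors x 0 = fset0.
    by apply/fsetP => y; rewrite in_fset0; apply/negbTE/imfsetP => -[i].
  exact: coverage0.
- exact: coverage_ge0.
- rewrite ler_pdivrMr// mul1r (@le_trans _ _ 1)// ?ler1n//; lra.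
move=> m /x_greedy[_ [M [[_ Mmax] gainM]]].
rewrite sensorsS -/(gain _ _ _ _ _); apply: le_trans gainM.
(* Without the factor [1 - eps], it remains to bound the gap divided by [l] by the maximal gain [M].
   The gap is at most the sum of the gains of the [l] points of [Pstar], each at most [M] because
   these points lie in [free]. *)
rewrite -mulrA; apply: ler_wpM2l; first by rewrite subr_ge0 ltW.
rewrite mulrC ler_pdivrMr// lerBlDl.
apply: le_trans (coverage_le_sum_gain free free_bounded free_measurable
  visibility_measurable k w w_nonincreasing w_ge0 (sensors x m) Pstar) _.
rewrite lerD2l -Pcard mulr_natr.
have -> : M *+ #|` Pstar| = \sum_(y <- Pstar) M.
  by rewrite big_const_seq count_predT iter_addr_0.
rewrite [leLHS]big_seq [leRHS]big_seq; apply: ler_sum => y yP.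
by apply: Mmax; exists y => //; exact: Pfree.
Qed.
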